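(* Let $X$ be a consistent fixed point of the Strong Kleene operator $\mathscr K$, i.e. $X\subseteq\mathrm{Sent}_{\mathcal L_{\mathrm T}}$, $X=\mathscr K(X)$, and there is no sentence $\varphi$ with $\varphi\wedge\neg\varphi\in X$. Let $\mathbb T_X=\{A\in\mathcal L_{\mathrm T} : A \text{ a sentence and } (\mathbb N,X)\vDash A\}$. Then $(\mathbb N,\mathbb T_X)\vDash \mathsf{CD}^+_{\mathrm T}$.
   Context: **Language and notation.** $\mathcal L_{\mathbb N}$ is the language of arithmetic over $\{\bar 0,\mathrm S,+,\times\}$ with finitely many additional function symbols for elementary syntactic operations: $\mathrm{num}$ (sending $n$ to the code of its numeral) and functions sending codes of expressions to the codes of their negation, conjunction, universal quantification, and the code of a term $t$ to the code of the atomic formula $\mathrm T(t)$, etc. $\mathbb N$ is its standard model. $\mathcal L_{\mathrm T}=\mathcal L_{\mathbb N}\cup\{\mathrm T\}$ with $\mathrm T$ a unary predicate; $(\mathbb N,S)$ interprets $\mathrm T$ by $S\subseteq\omega$. A Gödel numbering is fixed and expressions are identified with their codes. Logical primitives are $\neg,\wedge,\forall$, the others being defined. In axioms, $s,t$ range over codes of closed terms and $t^\circ$ is the value of $t$; $\varphi,\psi$ range over codes of sentences of $\mathcal L_{\mathrm T}$; $\varphi(v)$ ranges over codes of formulas with at most the variable $v$ free; $\varphi(t/v)$ is substitution. Connectives and predicates inside $\mathrm T$ (or $\mathrm D$) denote the corresponding syntactic operations on codes. $\mathrm F x:=\mathrm T(\neg x)$ (with $\neg$ the syntactic negation function). $\mathrm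 T\mathrm T\varphi$ and $\mathrm T\mathrm F\varphi$ are $\mathrm T$ applied to the code of $\mathrm T(\mathrm{num}(\varphi))$, resp. of $\mathrm F(\mathrm{num}(\varphi))$. For $t$ a closed term code, $\mathrm T\mathrm T t$ and $\mathrm T\mathrm F t$ are $\mathrm T$ applied to the code of the sentence $\mathrm T(t)$, resp. $\mathrm F(t)$. **The theory $\mathsf{CD}^+_{\mathrm T}$.** It is the $\mathcal L_{\mathrm T}$-theory consisting of $\mathsf{PA}$ with induction for all $\mathcal L_{\mathrm T}$-formulas and the following axioms, where $\mathrm D$ is not primitive but defined by $\mathrm D x:\leftrightarrow \mathrm T\mathrm T x\vee\mathrm T\mathrm F x$ (that is, $\mathrm T$ holds of the code of $\mathrm T(\mathrm{num}(x))$ or of the code of $\mathrm F(\mathrm{num}(x))$), and $\mathrm D t$ inside $\mathrm T$ or $\mathrm D$ is the code of the defining formula applied to $t$: - (T1) $\forall s\forall t(\mathrm T(s=t)\leftrightarrow s^\circ=t^\circ)$ - (T2$^+$) $\forall t(\mathrm D t^\circ\leftrightarrow \mathrm T\mathrm D t)$ - (T3) $\forall t(\mathrm D t^\circ\to(\mathrm T\mathrm T t\leftrightarrow \mathrm T t^\circ))$ - (T4) $\forall\varphi(\mathrm T(\neg\varphi)\leftrightarrow\neg\mathrm T\varphi)$ - (T5) $\forall\varphi,\psi(\mathrm T(\varphi\wedge\psi)\leftrightarrow \mathrm T\varphi\wedge\mathrm T\psi)$ - (T6) $\forall\varphi(v)(\mathrm T(\forall v\varphi)\leftrightarrow\forall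 t\,\mathrm T\varphi(t/v))$ - (D1) $\forall s\forall t\,\mathrm D(s=t)$ - (D2) $\forall t(\mathrm D\mathrm T t\leftrightarrow\mathrm D t^\circ)$ - (D3) $\forall t(\mathrm D\mathrm D t\leftrightarrow\mathrm D t^\circ)$ - (D4) $\forall\varphi(\mathrm D(\neg\varphi)\leftrightarrow\mathrm D\varphi)$ - (D5) $\forall\varphi,\psi\big(\mathrm D(\varphi\wedge\psi)\leftrightarrow((\mathrm D\varphi\wedge\mathrm D\psi)\vee(\mathrm D\varphi\wedge\mathrm T\neg\varphi)\vee(\mathrm D\psi\wedge\mathrm T\neg\psi))\big)$ - (D6) $\forall\varphi(v)\big(\mathrm D(\forall v\varphi)\leftrightarrow(\forall t\,\mathrm D\varphi(t/v)\vee\exists t(\mathrm D\varphi(t/v)\wedge\mathrm T\neg\varphi(t/v)))\big)$ - (R1) $\forall\varphi(v)\forall s\forall t(s^\circ=t^\circ\to(\mathrm T\varphi(s)\leftrightarrow\mathrm T\varphi(t)))$ - (R2) $\forall\varphi(v)\forall s\forall t(s^\circ=t^\circ\to(\mathrm D\varphi(s)\leftrightarrow\mathrm D\varphi(t)))$ **The operator $\mathscr K$.** For $X\subseteq\mathrm{Sent}_{\mathcal L_{\mathrm T}}$ (the set of codes of $\mathcal L_{\mathrm T}$-sentences), $n\in\mathscr K(X)$ iff $n\in\mathrm{Sent}_{\mathcal L_{\mathrm T}}$ and one of: $n$ is $s=t$ with $s^\circ=t^\circ$; $n$ is $s\neq t$ with $s^\circ\ne t^\circ$; $n$ is $\mathrm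 T t$ with $t^\circ\in X$; $n$ is $\neg\mathrm T t$ with $\neg t^\circ\in X$ or $t^\circ\in\omega\setminus\mathrm{Sent}_{\mathcal L_{\mathrm T}}$; $n$ is $\neg\neg\varphi$ with $\varphi\in X$; $n$ is $\varphi\wedge\psi$ with $\varphi\in X$ and $\psi\in X$; $n$ is $\neg(\varphi\wedge\psi)$ with $\neg\varphi\in X$ or $\neg\psi\in X$; $n$ is $\forall v\varphi$ with $\varphi(t/v)\in X$ for all closed terms $t$; $n$ is $\neg\forall v\varphi$ with $\neg\varphi(t/v)\in X$ for some closed term $t$.
   Formalization: The negation function symbol is taken to send every number that is not the code of a sentence (open formulas included) to the code of 0=0; with literal negation of open formulas, D2 and D3 fail when the value of t is an open formula. *)

(* Defs.v *)
From HB Require Import structures.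
From mathcomp Require Import all_boot.
From mathcomp Require Import boolp classical_sets.

Set Implicit Arguments.
Unset Strict Implicit.
Unset Printing Implicit Defensive.

Local Open Scope classical_set_scope.

(** * Syntax of L_T

    The function symbols of L_N, sorted by arity: those of arithmetic, and
    finitely many symbols for syntactic operations on codes.  The intended
    meaning of the latter is fixed by [fn0], [fn1], [fn2], [fn3] below. *)

Inductive sym0 := Zero.
Inductive sym1 :=
| Succ
| NumC    (* n |-> code of the numeral of n *)
| NegC    (* negation *)
| TrC     (* t |-> T(t) *)
| FaC     (* t |-> F(t), that is T(NegC(t)) *)
| DetC    (* t |-> D(t), that is T(TrC(NumC(t))) \/ T(FaC(NumC(t))) *)
| IsClT   (* characteristic function of the codes of closed terms *)
| IsSent. (* characteristic function of the codes of sentences of L_T *)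
Inductive sym2 :=
| Plus | Times
| EqC     (* s, t |-> s = t *)
| AndC    (* A, B |-> A /\ B *)
| AllC    (* v, A |-> forall v, A *)
| IsFml1  (* v, A |-> 1 if A is a formula with at most v free, else 0 *)
| ConsC   (* x, s |-> the sequence x :: s *)
| NthC    (* s, i |-> the i-th entry of the sequence s *)
| AppC.   (* i, s |-> f(s_0, ..., s_(k-1)), f the i-th symbol of arity k = |s| *)
Inductive sym3 :=
| SubC.   (* A, v, t |-> A(t/v) *)

Definition syms0 := [:: Zero].
Definition syms1 := [:: Succ; NumC; NegC; TrC; FaC; DetC; IsClT; IsSent].
Definition syms2 :=
  [:: Plus; Times; EqC; AndC; AllC; IsFml1; ConsC; NthC; AppC].
Definition syms3 := [:: SubC].

Definition index0 (f : sym0) : nat := 0.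
Definition index1 f :=
  match f with
  | Succ => 0 | NumC => 1 | NegC => 2 | TrC => 3
  | FaC => 4 | DetC => 5 | IsClT => 6 | IsSent => 7
  end.
Definition index2 f :=
  match f with
  | Plus => 0 | Times => 1 | EqC => 2 | AndC => 3 | AllC => 4
  | IsFml1 => 5 | ConsC => 6 | NthC => 7 | AppC => 8
  end.
Definition index3 (f : sym3) : nat := 0.

Lemma index0K : pcancel index0 (onth syms0). Proof. by case. Qed.
Lemma index1K : pcancel index1 (onth syms1). Proof. by case. Qed.
Lemma index2K : pcancel index2 (onth syms2). Proof. by case. Qed.
Lemma index3K : pcancel index3 (onth syms3). Proof. by case. Qed.

Inductive term :=
| Var of nat
| App0 of sym0
| App1 of sym1 & term
| App2 of sym2 & term & term
| App3 of sym3 & term & term & term.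

Inductive formula :=
| Eq of term & term
| Tr of term
| Neg of formula
| And of formula & formula
| All of nat & formula.

Definition Or A B := Neg (And (Neg A) (Neg B)).
Definition Imp A B := Neg (And A (Neg B)).
Definition Iff A B := And (Imp A B) (Imp B A).
Definition Ex v A := Neg (All v (Neg A)).
Definition Bot := Neg (Eq (App0 Zero) (App0 Zero)).

Fixpoint numeral n : term :=
  if n is m.+1 then App1 Succ (numeral m) else App0 Zero.

Fixpoint tvars t : seq nat :=
  match t with
  | Var n => [:: n]
  | App0 _ => [::]
  | App1 _ a => tvars a
  | App2 _ a b => tvars a ++ tvars b
  | App3 _ a b c => tvars a ++ tvars b ++ tvars c
  end.

Fixpoint fvars A : seq nat :=
  match A with
  | Eq s t => tvars s ++ tvars t
  | Tr t => tvars t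
  | Neg B => fvars B
  | And B C => fvars B ++ fvars C
  | All v B => [seq w <- fvars B | w != v]
  end.

Definition tclosed t : bool := nilp (tvars t).
Definition sentence A : bool := nilp (fvars A).
Definition fml1 v A : bool := all (pred1 v) (fvars A).

Fixpoint tsubst v u t : term :=
  match t with
  | Var n => if n == v then u else Var n
  | App0 f => App0 f
  | App1 f a => App1 f (tsubst v u a)
  | App2 f a b => App2 f (tsubst v u a) (tsubst v u b)
  | App3 f a b c => App3 f (tsubst v u a) (tsubst v u b) (tsubst v u c)
  end.

(* Bound variables are not renamed: this is A(u/v) when no variable of u other
   than v is bound in A, in particular when u is closed or is S v. *)
Fixpoint subst v u A : formula :=
  match A with
  | Eq s t => Eq (tsubst v u s) (tsubst v u t)
  | Tr t => Tr (tsubst v u t)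
  | Neg B => Neg (subst v u B)
  | And B C => And (subst v u B) (subst v u C)
  | All w B => if w == v then All w B else All w (subst v u B)
  end.

Definition uclosure A : formula := foldr All A (undup (fvars A)).

(* The formulas F(u) := T(neg u) and D(u) := TTu \/ TFu. *)
Definition Fa u : formula := Tr (App1 NegC u).
Definition Det u : formula :=
  Or (Tr (App1 TrC (App1 NumC u))) (Tr (App1 FaC (App1 NumC u))).

(** * Goedel numbering

    Terms and formulas are numbered together, so that a number codes at most
    one expression. *)

Fixpoint term_tree t : GenTree.tree nat :=
  match t with
  | Var n => GenTree.Leaf n
  | App0 f => GenTree.Node (index0 f) [::]
  | App1 f a => GenTree.Node (index1 f) [:: term_tree a]
  | App2 f a b => GenTree.Node (index2 f) [:: term_tree a; term_tree b]
  | App3 f a b c =>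
      GenTree.Node (index3 f) [:: term_tree a; term_tree b; term_tree c]
  end.

Fixpoint tree_term (T : GenTree.tree nat) : option term :=
  match T with
  | GenTree.Leaf n => Some (Var n)
  | GenTree.Node i [::] => omap App0 (onth syms0 i)
  | GenTree.Node i [:: a] =>
      if (onth syms1 i, tree_term a) is (Some f, Some a)
      then Some (App1 f a) else None
  | GenTree.Node i [:: a; b] =>
      if (onth syms2 i, tree_term a, tree_term b) is (Some f, Some a, Some b)
      then Some (App2 f a b) else None
  | GenTree.Node i [:: a; b; c] =>
      if (onth syms3 i, tree_term a, tree_term b, tree_term c)
        is (Some f, Some a, Some b, Some c)
      then Some (App3 f a b c) else None
  | _ => None
  end.

Lemma term_treeK : pcancel term_tree tree_term.
Proof.
elim=> [n|f|f a IHa|f a IHa b IHb|f a IHa b IHb c IHc] //=.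
- by case: f.
- by rewrite index1K IHa.
- by rewrite index2K IHa IHb.
- by case: f; rewrite IHa IHb IHc.
Qed.

HB.instance Definition _ := Countable.copy term (pcan_type term_treeK).

Fixpoint formula_tree A : GenTree.tree (nat + term) :=
  match A with
  | Eq s t => GenTree.Node 0 [:: GenTree.Leaf (inr s); GenTree.Leaf (inr t)]
  | Tr t => GenTree.Node 1 [:: GenTree.Leaf (inr t)]
  | Neg B => GenTree.Node 2 [:: formula_tree B]
  | And B C => GenTree.Node 3 [:: formula_tree B; formula_tree C]
  | All v B => GenTree.Node 4 [:: GenTree.Leaf (inl v); formula_tree B]
  end.

Fixpoint tree_formula (T : GenTree.tree (nat + term)) : option formula :=
  match T with
  | GenTree.Node 0 [:: GenTree.Leaf (inr s); GenTree.Leaf (inr t)] =>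
      Some (Eq s t)
  | GenTree.Node 1 [:: GenTree.Leaf (inr t)] => Some (Tr t)
  | GenTree.Node 2 [:: B] => omap Neg (tree_formula B)
  | GenTree.Node 3 [:: B; C] =>
      if (tree_formula B, tree_formula C) is (Some B, Some C)
      then Some (And B C) else None
  | GenTree.Node 4 [:: GenTree.Leaf (inl v); B] =>
      omap (All v) (tree_formula B)
  | _ => None
  end.

Lemma formula_treeK : pcancel formula_tree tree_formula.
Proof.
elim=> [s t|t|B IHB|B IHB C IHC|v B IHB] //=.
- by rewrite IHB.
- by rewrite IHB IHC.
- by rewrite IHB.
Qed.

HB.instance Definition _ := Countable.copy formula (pcan_type formula_treeK).

Definition expr : countType := (term + formula)%type.

(* locked, as evaluating a code is hopeless *)
HB.lock Definition codeT (t : term) : nat := pickle (inl t : expr).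
HB.lock Definition code (A : formula) : nat := pickle (inr A : expr).

(* [unpickle] is not injective, whence [pickle_inv] *)
Definition decT n : option term :=
  if (pickle_inv n : option expr) is Some (inl t) then Some t else None.
Definition decF n : option formula :=
  if (pickle_inv n : option expr) is Some (inr A) then Some A else None.

HB.lock Definition codeS (s : seq nat) : nat := pickle s.
Definition decS n : seq nat := odflt [::] (unpickle n).

(** * The standard model

    A syntactic operation takes an immaterial value on arguments of the wrong
    kind, with one exception: [NegC] sends every number that is not the code of
    a sentence to the code of 0 = 0.  This is not immaterial.  The axioms D2
    and D3 apply D to arbitrary values t°, and if t° is not a sentence then
    neg T(t) is in every fixed point of K, so that D(T t) holds; then D2
    demands D t°, that is F t°, that is, neg(t°) must be in the fixed point. *)

Definition fn0 (f : sym0) : nat := 0.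

Definition negC n : nat :=
  if decF n is Some A then
    if sentence A then code (Neg A) else code (Eq (App0 Zero) (App0 Zero))
  else code (Eq (App0 Zero) (App0 Zero)).

Definition fn1 f (x : nat) : nat :=
  match f with
  | Succ => x.+1
  | NumC => codeT (numeral x)
  | NegC => negC x
  | TrC => if decT x is Some t then code (Tr t) else 0
  | FaC => if decT x is Some t then code (Fa t) else 0
  | DetC => if decT x is Some t then code (Det t) else 0
  | IsClT => if decT x is Some t then tclosed t else false
  | IsSent => if decF x is Some A then sentence A else false
  end.

Definition app_code i (ts : seq term) : nat :=
  match ts with
  | [::] => if onth syms0 i is Some f then codeT (App0 f) else 0
  | [:: a] => if onth syms1 i is Some f then codeT (App1 f a) else 0
  | [:: a; b] => if onth syms2 i is Some f then codeT (App2 f a b) else 0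
  | [:: a; b; c] => if onth syms3 i is Some f then codeT (App3 f a b c) else 0
  | _ => 0
  end.

Definition fn2 f (x y : nat) : nat :=
  match f with
  | Plus => x + y
  | Times => x * y
  | EqC => if (decT x, decT y) is (Some s, Some t) then code (Eq s t) else 0
  | AndC => if (decF x, decF y) is (Some A, Some B) then code (And A B) else 0
  | AllC =>
      if (decT x, decF y) is (Some (Var v), Some A) then code (All v A) else 0
  | IsFml1 =>
      if (decT x, decF y) is (Some (Var v), Some A) then fml1 v A else false
  | ConsC => codeS (x :: decS y)
  | NthC => nth 0 (decS x) y
  | AppC => app_code x (pmap decT (decS y))
  end.

Definition fn3 (f : sym3) (x y z : nat) : nat :=
  if (decF x, decT y, decT z) is (Some A, Some (Var v), Some t)
  then code (subst v t A) else 0.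

Fixpoint eval (rho : nat -> nat) t : nat :=
  match t with
  | Var n => rho n
  | App0 f => fn0 f
  | App1 f a => fn1 f (eval rho a)
  | App2 f a b => fn2 f (eval rho a) (eval rho b)
  | App3 f a b c => fn3 f (eval rho a) (eval rho b) (eval rho c)
  end.

(* t°, for t closed *)
Definition value t : nat := eval (fun=> 0) t.

Definition update (rho : nat -> nat) v n : nat -> nat :=
  fun w => if w == v then n else rho w.

(* satisfaction in (N, S) *)
Fixpoint sat (S : set nat) (rho : nat -> nat) A : Prop :=
  match A with
  | Eq s t => eval rho s = eval rho t
  | Tr t => S (eval rho t)
  | Neg B => ~ sat S rho B
  | And B C => sat S rho B /\ sat S rho C
  | All v B => forall n, sat S (update rho v n) B
  end.

Definition holds (S : set nat) A : Prop := forall rho, sat S rho A.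

Definition models (S : set nat) (Th : set formula) : Prop :=
  forall A, Th A -> holds S A.

Definition Sent : set nat := [set n | exists2 A, sentence A & n = code A].

(* T_X *)
Definition truths (X : set nat) : set nat :=
  [set n | exists A, [/\ sentence A, n = code A & holds X A]].

(** * The theory CD+_T *)

Definition isClT u : formula := Eq (App1 IsClT u) (numeral 1).
Definition isSent u : formula := Eq (App1 IsSent u) (numeral 1).
Definition isFml1 v u : formula := Eq (App2 IsFml1 v u) (numeral 1).

(* [valF s u] expresses that s codes a closed term with value u: there are
   sequences x10 and x11 such that each entry of x10 up to the index x12 is the
   code of the application of a function symbol to earlier entries, the entry
   of x11 at the same place is the corresponding value, and the entries at
   x12 are s and u.  The variables 10 to 17 must not occur in s, u. *)
Definition ltF s t : formula :=
  Ex 17 (Eq (App2 Plus (App1 Succ s) (Var 17)) t).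

Definition seqT : seq term -> term :=
  foldr (App2 ConsC) (numeral (codeS [::])).

Definition appT i (ts : seq term) : term := App2 AppC (numeral i) (seqT ts).

Definition tm i := App2 NthC (Var 10) i.
Definition vl i := App2 NthC (Var 11) i.

Definition entry i s u : formula := And (Eq (tm i) s) (Eq (vl i) u).

Definition step0 f : formula :=
  entry (Var 13) (appT (index0 f) [::]) (App0 f).
Definition step1 f : formula :=
  Ex 14 (And (ltF (Var 14) (Var 13))
    (entry (Var 13) (appT (index1 f) [:: tm (Var 14)])
                    (App1 f (vl (Var 14))))).
Definition step2 f : formula :=
  Ex 14 (Ex 15 (And (And (ltF (Var 14) (Var 13)) (ltF (Var 15) (Var 13)))
    (entry (Var 13) (appT (index2 f) [:: tm (Var 14); tm (Var 15)])
                    (App2 f (vl (Var 14)) (vl (Var 15)))))).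
Definition step3 f : formula :=
  Ex 14 (Ex 15 (Ex 16 (And (And (ltF (Var 14) (Var 13)) (ltF (Var 15) (Var 13)))
                           (And (ltF (Var 16) (Var 13))
    (entry (Var 13) (appT (index3 f) [:: tm (Var 14); tm (Var 15); tm (Var 16)])
                    (App3 f (vl (Var 14)) (vl (Var 15)) (vl (Var 16)))))))).

Definition step : formula :=
  foldr Or Bot (map step0 syms0 ++ map step1 syms1 ++
                map step2 syms2 ++ map step3 syms3).

Definition valF s u : formula :=
  Ex 10 (Ex 11 (Ex 12 (And (entry (Var 12) s u)
    (All 13 (Imp (ltF (Var 13) (App1 Succ (Var 12))) step))))).

Definition sameval s t : formula := Ex 9 (And (valF s (Var 9)) (valF t (Var 9))).

Definition AllClT v A : formula := All v (Imp (isClT (Var v)) A).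
Definition ExClT v A : formula := Ex v (And (isClT (Var v)) A).
Definition AllSent v A : formula := All v (Imp (isSent (Var v)) A).
(* for all formulas x_w with at most the variable x_v free *)
Definition AllFml1 v w A : formula :=
  All v (All w (Imp (isFml1 (Var v) (Var w)) A)).
(* A(t°), where y stands for t° *)
Definition AtVal t y A : formula := All y (Imp (valF t (Var y)) A).

Local Notation vx := (Var 0).
Local Notation vy := (Var 1).
Local Notation vs := (Var 2).
Local Notation vt := (Var 3).
Local Notation vv := (Var 4).
Local Notation sub A u := (App3 SubC A vv u).
Local Notation neg u := (App1 NegC u).

Definition T1 := AllClT 2 (AllClT 3
  (Iff (Tr (App2 EqC vs vt)) (sameval vs vt))).
Definition T2plus := AllClT 3 (AtVal vt 0
  (Iff (Det vx) (Tr (App1 DetC vt)))).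
Definition T3 := AllClT 3 (AtVal vt 0
  (Imp (Det vx) (Iff (Tr (App1 TrC vt)) (Tr vx)))).
Definition T4 := AllSent 0 (Iff (Tr (neg vx)) (Neg (Tr vx))).
Definition T5 := AllSent 0 (AllSent 1
  (Iff (Tr (App2 AndC vx vy)) (And (Tr vx) (Tr vy)))).
Definition T6 := AllFml1 4 0
  (Iff (Tr (App2 AllC vv vx)) (AllClT 3 (Tr (sub vx vt)))).

Definition D1 := AllClT 2 (AllClT 3 (Det (App2 EqC vs vt))).
Definition D2 := AllClT 3 (AtVal vt 0
  (Iff (Det (App1 TrC vt)) (Det vx))).
Definition D3 := AllClT 3 (AtVal vt 0
  (Iff (Det (App1 DetC vt)) (Det vx))).
Definition D4 := AllSent 0 (Iff (Det (neg vx)) (Det vx)).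
Definition D5 := AllSent 0 (AllSent 1
  (Iff (Det (App2 AndC vx vy))
       (Or (Or (And (Det vx) (Det vy)) (And (Det vx) (Tr (neg vx))))
           (And (Det vy) (Tr (neg vy)))))).
Definition D6 := AllFml1 4 0
  (Iff (Det (App2 AllC vv vx))
       (Or (AllClT 3 (Det (sub vx vt)))
           (ExClT 3 (And (Det (sub vx vt)) (Tr (neg (sub vx vt))))))).

Definition R1 := AllFml1 4 0 (AllClT 2 (AllClT 3
  (Imp (sameval vs vt) (Iff (Tr (sub vx vs)) (Tr (sub vx vt)))))).
Definition R2 := AllFml1 4 0 (AllClT 2 (AllClT 3
  (Imp (sameval vs vt) (Iff (Det (sub vx vs)) (Det (sub vx vt)))))).

Definition induction v A : formula :=
  uclosure (Imp (And (subst v (App0 Zero) A)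
                    (All v (Imp A (subst v (App1 Succ (Var v)) A))))
               (All v A)).

(* [Syn]: the defining axioms of the symbols for syntactic operations *)
Inductive PA_T (Syn : set formula) : set formula :=
| PA_syn A : Syn A -> PA_T Syn A
| PA_S0 : PA_T Syn (All 0 (Neg (Eq (App1 Succ (Var 0)) (App0 Zero))))
| PA_SS : PA_T Syn (All 0 (All 1
    (Imp (Eq (App1 Succ (Var 0)) (App1 Succ (Var 1))) (Eq (Var 0) (Var 1)))))
| PA_D0 : PA_T Syn (All 0 (Eq (App2 Plus (Var 0) (App0 Zero)) (Var 0)))
| PA_DS : PA_T Syn (All 0 (All 1
    (Eq (App2 Plus (Var 0) (App1 Succ (Var 1)))
        (App1 Succ (App2 Plus (Var 0) (Var 1))))))
| PA_M0 : PA_T Syn (All 0 (Eq (App2 Times (Var 0) (App0 Zero)) (App0 Zero)))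
| PA_MS : PA_T Syn (All 0 (All 1
    (Eq (App2 Times (Var 0) (App1 Succ (Var 1)))
        (App2 Plus (App2 Times (Var 0) (Var 1)) (Var 0)))))
| PA_ind v A : PA_T Syn (induction v A).

Inductive CDplus_T (Syn : set formula) : set formula :=
| CD_PA A : PA_T Syn A -> CDplus_T Syn A
| CD_T1 : CDplus_T Syn T1
| CD_T2plus : CDplus_T Syn T2plus
| CD_T3 : CDplus_T Syn T3
| CD_T4 : CDplus_T Syn T4
| CD_T5 : CDplus_T Syn T5
| CD_T6 : CDplus_T Syn T6
| CD_D1 : CDplus_T Syn D1
| CD_D2 : CDplus_T Syn D2
| CD_D3 : CDplus_T Syn D3
| CD_D4 : CDplus_T Syn D4
| CD_D5 : CDplus_T Syn D5
| CD_D6 : CDplus_T Syn D6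
| CD_R1 : CDplus_T Syn R1
| CD_R2 : CDplus_T Syn R2.

Fixpoint arithmetical A : bool :=
  match A with
  | Eq _ _ => true
  | Tr _ => false
  | Neg B => arithmetical B
  | And B C => arithmetical B && arithmetical C
  | All _ B => arithmetical B
  end.

(* The defining axioms of the syntactic operations depend on the numbering and
   are left open: any true L_N-sentences will do. *)
Definition syntax_axioms (Syn : set formula) : Prop :=
  forall A, Syn A -> [/\ sentence A, arithmetical A & holds set0 A].

(** * The Strong Kleene operator *)

Definition Kclause (X : set nat) A : Prop :=
  match A with
  | Eq s t => value s = value t
  | Neg (Eq s t) => value s <> value t
  | Tr t => X (value t)
  | Neg (Tr t) => X (negC (value t)) \/ ~ Sent (value t)
  | Neg (Neg B) => X (code B)
  | And B C => X (code B) /\ X (code C)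
  | Neg (And B C) => X (code (Neg B)) \/ X (code (Neg C))
  | All v B => forall t, tclosed t -> X (code (subst v t B))
  | Neg (All v B) => exists2 t, tclosed t & X (code (Neg (subst v t B)))
  end.

Definition K (X : set nat) : set nat :=
  [set n | exists A, [/\ sentence A, n = code A & Kclause X A]].

Definition consistent (X : set nat) : Prop :=
  ~ exists2 A, sentence A & X (code (And A (Neg A))).

(* Main.v *)
Require Import Defs.
From HB Require Import structures.
From mathcomp Require Import all_boot.
From mathcomp Require Import boolp classical_sets.

Set Implicit Arguments.
Unset Strict Implicit.
Unset Printing Implicit Defensive.

Local Open Scope classical_set_scope.

(** Let X be a consistent fixed point of K and let T be its closed-off truth
    set, the sentences true in (N, X).

    Over T, the defined predicate D holds of n exactly when X contains n or the
    negation of n ([sat_Det_truths]): the sentence T(num n) is true in (N, X)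
    iff n is in X, and F(num n) iff [negC n] is.  Over X itself D(u) has the same
    meaning, which is the content of T2+.  So D means having a Strong Kleene
    truth value, and T means being classically true with X as the extension of
    the truth predicate.

    To compute with Strong Kleene values compositionally, [ksat] extends them to
    formulas under assignments.  Every fixed point agrees with it on sentences
    ([ksatP], by induction on size), so that D on codes of sentences obeys the
    Strong Kleene clauses; since [ksat] depends on closed terms only through
    their values, R2 holds as well.  Consistency enters through [ksat_sound]: a
    sentence with a Kleene value has that value classically.  Hence T and X agree
    on what is determinate ([determinate_truths], which is T3), and in D5 and D6
    the conjunction of D(A) and T(neg A) says that A is Kleene-false
    ([determinate_false]).  T1, T4, T5, T6 and R1 are the Tarski clauses of
    classical satisfaction in (N, X).

    A number n that is not a sentence is always determinate: [negC n] is the code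
    of 0 = 0, hence in X.  This agrees with neg T(t) being in X whenever the value
    of t is not a sentence, so D2 and D3 hold for such t too.

    The remaining work is arithmetical: the formula defining the value of a
    closed term has to be shown correct ([sat_valF]). *)

(** * Assignments and substitution *)

Lemma updateE rho v n w : update rho v n w = if w == v then n else rho w.
Proof. by []. Qed.

Lemma update_same rho v m n : update (update rho v m) v n = update rho v n.
Proof. by apply: funext => w; rewrite !updateE; case: eqP. Qed.

Lemma update_swap rho v w m n : w != v ->
  update (update rho v m) w n = update (update rho w n) v m.
Proof.
move=> neq; apply: funext => x; rewrite !updateE.
by case: (x =P w) => [->|//]; rewrite (negPf neq).
Qed.

Lemma eval_ext rho rho' t :
  {in tvars t, rho =1 rho'} -> eval rho t = eval rho' t.
Proof.
elim: t => [n|f|f a IHa|f a IHa b IHb|f a IHa b IHb c IHc] //= h.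
- by apply: h; rewrite inE.
- by rewrite IHa.
- by rewrite IHa ?IHb // => w wP; apply: h; rewrite mem_cat wP ?orbT.
- by rewrite IHa ?IHb ?IHc // => w wP; apply: h; rewrite !mem_cat wP ?orbT.
Qed.

Lemma eval_closed rho t : tclosed t -> eval rho t = value t.
Proof. by move=> /nilP t0; apply: eval_ext => w; rewrite t0. Qed.

Lemma eval_update rho v n t :
  v \notin tvars t -> eval (update rho v n) t = eval rho t.
Proof.
move=> vt; apply: eval_ext => w wt; rewrite updateE.
by case: eqP => // wv; rewrite -wv wt in vt.
Qed.

Lemma eval_numeral rho n : eval rho (numeral n) = n.
Proof. by elim: n => //= n ->. Qed.

Lemma tclosed_numeral n : tclosed (numeral n).
Proof. by elim: n. Qed.

Lemma value_numeral n : value (numeral n) = n.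
Proof. exact: eval_numeral. Qed.

Lemma sat_ext S rho rho' A :
  {in fvars A, rho =1 rho'} -> sat S rho A <-> sat S rho' A.
Proof.
elim: A rho rho' => [s t|t|B IH|B IHB C IHC|v B IH] rho rho' h /=.
- rewrite (@eval_ext rho rho' s) ?(@eval_ext rho rho' t) //.
  + by move=> w wP; apply: h; rewrite /= mem_cat wP orbT.
  + by move=> w wP; apply: h; rewrite /= mem_cat wP.
- by rewrite (@eval_ext rho rho').
- by have := IH _ _ h; tauto.
- have hB : {in fvars B, rho =1 rho'}.
    by move=> w wP; apply: h; rewrite /= mem_cat wP.
  have hC : {in fvars C, rho =1 rho'}.
    by move=> w wP; apply: h; rewrite /= mem_cat wP orbT.
  by have := (IHB _ _ hB, IHC _ _ hC); tauto.
- have hB n : {in fvars B, update rho v n =1 update rho' v n}.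
    move=> w wP; rewrite !updateE; case: eqP => // /eqP wv.
    by apply: h; rewrite /= mem_filter wv.
  by split=> hn n; have := IH _ _ (hB n); have := hn n; tauto.
Qed.

Lemma sat_sentence S rho rho' A :
  sentence A -> sat S rho A <-> sat S rho' A.
Proof. by move=> /nilP A0; apply: sat_ext => w; rewrite A0. Qed.

Lemma eval_tsubst rho v u t :
  eval rho (tsubst v u t) = eval (update rho v (eval rho u)) t.
Proof.
elim: t => [n|f|f a IHa|f a IHa b IHb|f a IHa b IHb c IHc] //=.
- by rewrite updateE; case: eqP.
- by rewrite IHa.
- by rewrite IHa IHb.
- by rewrite IHa IHb IHc.
Qed.

(** The hypothesis rules out capture: it covers the closed terms and S v. *)
Lemma sat_subst S rho v u A : {subset tvars u <= [:: v]} ->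
  sat S rho (subst v u A) <-> sat S (update rho v (eval rho u)) A.
Proof.
move=> uv; elim: A rho => [s t|t|B IH|B IHB C IHC|w B IH] rho /=.
- by rewrite !eval_tsubst.
- by rewrite eval_tsubst.
- by have := IH rho; tauto.
- by have := (IHB rho, IHC rho); tauto.
- case: eqP => [->|/eqP wv] /=.
    by split=> h n; move: (h n); rewrite update_same.
  have wu : w \notin tvars u by apply: contra wv => /uv; rewrite inE.
  have swap n : sat S (update rho w n) (subst v u B) <->
      sat S (update (update rho v (eval rho u)) w n) B.
    by rewrite update_swap // -(eval_update rho n wu); apply: IH.
  by split=> h n; apply/swap/h.
Qed.

Lemma closed_subset t v : tclosed t -> {subset tvars t <= [:: v]}.
Proof. by move=> /nilP ->. Qed.

Lemma tvars_tsubst v u t : tclosed u ->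
  tvars (tsubst v u t) = [seq w <- tvars t | w != v].
Proof.
move=> /nilP u0.
elim: t => [n|f|f a IHa|f a IHa b IHb|f a IHa b IHb c IHc] //=.
- by case: eqP.
- by rewrite filter_cat IHa IHb.
- by rewrite !filter_cat IHa IHb IHc.
Qed.

Lemma fvars_subst v u A : tclosed u ->
  fvars (subst v u A) = [seq w <- fvars A | w != v].
Proof.
move=> uc; elim: A => [s t|t|B IH|B IHB C IHC|w B IH] /=.
- by rewrite filter_cat !tvars_tsubst.
- by rewrite tvars_tsubst.
- by [].
- by rewrite filter_cat IHB IHC.
- case: eqP => [->|_] /=.
    by rewrite filter_id.
  by rewrite IH -!filter_predI; apply: eq_filter => x /=; rewrite andbC.
Qed.

Lemma sentence_All v A : sentence (All v A) = fml1 v A.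
Proof. 
by rewrite /sentence /fml1 /=; elim: (fvars A) => //= x s IH; case: eqP.
Qed.

Lemma sentence_subst v u A : tclosed u ->
  sentence (subst v u A) = fml1 v A.
Proof. by move=> uc; rewrite -sentence_All /sentence /= fvars_subst. Qed.

Lemma sentence_And A B : sentence (And A B) = sentence A && sentence B.
Proof. by rewrite /sentence /= /nilp size_cat addn_eq0. Qed.

(** * Codes *)

Lemma codeTK t : decT (codeT t) = Some t.
Proof. by rewrite /decT codeT.unlock pickleK_inv. Qed.

Lemma codeT_inj : injective codeT.
Proof. by move=> s t st; have := codeTK s; rewrite st codeTK => -[]. Qed.

Lemma codeFK A : decF (code A) = Some A.
Proof. by rewrite /decF code.unlock pickleK_inv. Qed.

Lemma decTP n t : decT n = Some t -> n = codeT t.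
Proof.
rewrite /decT codeT.unlock; have := @pickle_invK expr n.
by case: (pickle_inv n) => [[t'|A]|] //= <- [->].
Qed.

Lemma decFP n A : decF n = Some A -> n = code A.
Proof.
rewrite /decF code.unlock; have := @pickle_invK expr n.
by case: (pickle_inv n) => [[t'|A']|] //= <- [->].
Qed.

Lemma codeSK s : decS (codeS s) = s.
Proof. by rewrite /decS codeS.unlock pickleK. Qed.

Lemma code_inj : injective code.
Proof. by move=> A B AB; have := codeFK A; rewrite AB codeFK => -[]. Qed.

(** * Satisfaction of the defined connectives and relativized quantifiers *)

Lemma sat_And S rho A B : sat S rho (And A B) <-> sat S rho A /\ sat S rho B.
Proof. by []. Qed.

Lemma sat_All S rho v A :
  sat S rho (All v A) <-> forall n, sat S (update rho v n) A.
Proof. by []. Qed.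

Lemma sat_Or S rho A B : sat S rho (Or A B) <-> sat S rho A \/ sat S rho B.
Proof. by rewrite /=; have := (EM (sat S rho A), EM (sat S rho B)); tauto. Qed.

Lemma sat_Imp S rho A B : sat S rho (Imp A B) <-> (sat S rho A -> sat S rho B).
Proof. by rewrite /=; have := (EM (sat S rho A), EM (sat S rho B)); tauto. Qed.

Lemma sat_Iff S rho A B :
  sat S rho (Iff A B) <-> (sat S rho A <-> sat S rho B).
Proof.
by have := (sat_Imp S rho A B, sat_Imp S rho B A); rewrite /=; tauto.
Qed.

Lemma sat_Ex S rho v A :
  sat S rho (Ex v A) <-> exists n, sat S (update rho v n) A.
Proof.
split=> [/existsNP[n /contrapT h]|[n h] /(_ n)]; last exact.
by exists n.
Qed.

Lemma sat_bigOr S rho s :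
  sat S rho (foldr Or Bot s) <-> exists2 A, A \in s & sat S rho A.
Proof.
elim: s => [|A s IH]; first by rewrite /=; split=> [|[]].
split=> [/sat_Or[hA|/IH[B Bs hB]]|[B]].
- by exists A => //; rewrite inE eqxx.
- by exists B => //; rewrite inE Bs orbT.
- rewrite inE => /orP[/eqP-> hA|Bs hB]; apply/sat_Or; first by left.
  by right; apply/IH; exists B.
Qed.

Lemma sat_ltF S rho s t : 17 \notin tvars s -> 17 \notin tvars t ->
  sat S rho (ltF s t) <-> eval rho s < eval rho t.
Proof.
move=> s17 t17; split=> [/sat_Ex[n]|lt]; last apply/sat_Ex.
  by rewrite /= !eval_update // => <-; rewrite leq_addr.
by exists (eval rho t - (eval rho s).+1); rewrite /= !eval_update // subnKC.
Qed.

Lemma sat_isClT S rho u :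
  sat S rho (isClT u) <-> exists t, tclosed t /\ eval rho u = codeT t.
Proof.
rewrite /isClT [numeral]lock /= -lock eval_numeral.
split=> [|[t [tc ->]]]; last by rewrite codeTK tc.
case E: (decT _) => [t|] //; rewrite (decTP E).
by case tc: (tclosed t) => // _; exists t.
Qed.

Lemma sat_isSent S rho u :
  sat S rho (isSent u) <-> exists A, sentence A /\ eval rho u = code A.
Proof.
rewrite /isSent [numeral]lock /= -lock eval_numeral.
split=> [|[A [Ac ->]]]; last by rewrite codeFK Ac.
case E: (decF _) => [A|] //; rewrite (decFP E).
by case Ac: (sentence A) => // _; exists A.
Qed.

Lemma sat_isFml1 S rho u w :
  sat S rho (isFml1 u w) <-> exists v A,
    [/\ fml1 v A, eval rho u = codeT (Var v) & eval rho w = code A].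
Proof.
rewrite /isFml1 [numeral]lock /= -lock eval_numeral.
split=> [|[v [A [Av -> ->]]]]; last by rewrite codeTK codeFK Av.
case E: (decT _) => [[v||||]|] //; case F: (decF _) => [A|] //.
rewrite (decTP E) (decFP F).
by case Av: (fml1 v A) => // _; exists v, A.
Qed.

Lemma sat_AllImp S rho v A B : sat S rho (All v (Imp A B)) <->
  forall n, sat S (update rho v n) A -> sat S (update rho v n) B.
Proof. by split=> h n; apply/sat_Imp/h. Qed.

Lemma sat_AllClT S rho v A : sat S rho (AllClT v A) <->
  forall t, tclosed t -> sat S (update rho v (codeT t)) A.
Proof.
split=> [/sat_AllImp h t tc|h].
  by apply: h; apply/sat_isClT; exists t; rewrite /= updateE eqxx.
apply/sat_AllImp => n /sat_isClT[t [tc]].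
by rewrite /= updateE eqxx => ->; apply: h.
Qed.

Lemma sat_ExClT S rho v A : sat S rho (ExClT v A) <->
  exists2 t, tclosed t & sat S (update rho v (codeT t)) A.
Proof.
split=> [/sat_Ex[n /sat_And[/sat_isClT[t [tc]]]]|[t tc h]].
  by rewrite /= updateE eqxx => -> h; exists t.
apply/sat_Ex; exists (codeT t); split=> //; apply/sat_isClT; exists t.
by rewrite /= updateE eqxx.
Qed.

Lemma sat_AllSent S rho v A : sat S rho (AllSent v A) <->
  forall B, sentence B -> sat S (update rho v (code B)) A.
Proof.
split=> [/sat_AllImp h B Bc|h].
  by apply: h; apply/sat_isSent; exists B; rewrite /= updateE eqxx.
apply/sat_AllImp => n /sat_isSent[B [Bc]].
by rewrite /= updateE eqxx => ->; apply: h.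
Qed.

Lemma sat_AllFml1 S rho v w A : v != w -> sat S rho (AllFml1 v w A) <->
  forall z B, fml1 z B ->
    sat S (update (update rho v (codeT (Var z))) w (code B)) A.
Proof.
move=> vw; split=> [/sat_All h z B zB|h]; last apply/sat_All => m.
  have /sat_AllImp := h (codeT (Var z)); apply; apply/sat_isFml1.
  by exists z, B; rewrite /= !updateE !eqxx (negPf vw).
apply/sat_AllImp => n /sat_isFml1[z [B [zB]]].
rewrite /= !updateE !eqxx (negPf vw) => -> ->.
exact: h.
Qed.

(** * Values of closed terms *)

Lemma eval_seqT rho s : eval rho (seqT s) = codeS (map (eval rho) s).
Proof.
elim: s => [|t s IH]; first exact: eval_numeral.
by rewrite /= -/(seqT s) IH codeSK.
Qed.

Definition appv i (s : seq nat) : nat := app_code i (pmap decT s).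

Lemma eval_appT rho i s : eval rho (appT i s) = appv i (map (eval rho) s).
Proof.
rewrite /appv -[map _ s in RHS]codeSK -eval_seqT.
by rewrite -[in RHS](eval_numeral rho i).
Qed.

Lemma sat_entry S rho i s u : sat S rho (entry i s u) <->
  nth 0 (decS (rho 10)) (eval rho i) = eval rho s /\
  nth 0 (decS (rho 11)) (eval rho i) = eval rho u.
Proof. by []. Qed.

(** The i-th entries are obtained from earlier ones by one function symbol: a
    lists codes of terms and c the corresponding values. *)
Inductive built (a c : nat -> nat) (i : nat) : Prop :=
| built0 f of a i = appv (index0 f) [::] & c i = fn0 f
| built1 f j of j < i & a i = appv (index1 f) [:: a j] & c i = fn1 f (c j)
| built2 f j k of j < i & k < i & a i = appv (index2 f) [:: a j; a k]
    & c i = fn2 f (c j) (c k)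
| built3 f j k l of j < i & k < i & l < i
    & a i = appv (index3 f) [:: a j; a k; a l] & c i = fn3 f (c j) (c k) (c l).

HB.instance Definition _ := Equality.copy sym0 (pcan_type index0K).
HB.instance Definition _ := Equality.copy sym1 (pcan_type index1K).
HB.instance Definition _ := Equality.copy sym2 (pcan_type index2K).
HB.instance Definition _ := Equality.copy sym3 (pcan_type index3K).

Lemma sat_step S rho : sat S rho step <->
  built (nth 0 (decS (rho 10))) (nth 0 (decS (rho 11))) (rho 13).
Proof.
split=> [/sat_bigOr[A]|].
  rewrite !mem_cat => /or4P[] /mapP[f _ ->].
  - by move=> /sat_entry[]; rewrite eval_appT; apply: built0.
  - move=> /sat_Ex[j /sat_And[/sat_ltF lt /sat_entry]].
    by rewrite eval_appT => -[ha hc]; apply: built1 ha hc; apply: lt.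
  - move=> /sat_Ex[j /sat_Ex[k /sat_And[/sat_And[/sat_ltF lt1 /sat_ltF lt2] /sat_entry]]].
    by rewrite eval_appT => -[ha hc]; apply: built2 ha hc; [apply: lt1|apply: lt2].
  - move=> /sat_Ex[j /sat_Ex[k /sat_Ex[l
      /sat_And[/sat_And[/sat_ltF lt1 /sat_ltF lt2] /sat_And[/sat_ltF lt3 /sat_entry]]]]].
    rewrite eval_appT => -[ha hc].
    by apply: built3 ha hc; [apply: lt1|apply: lt2|apply: lt3].
move=> b; apply/sat_bigOr.
case: b => [f ha hc|f j lt ha hc|f j k lt1 lt2 ha hc|f j k l lt1 lt2 lt3 ha hc].
- exists (step0 f); first by rewrite !mem_cat; apply/or4P/Or41/map_f; case: (f).
  by apply/sat_entry; rewrite eval_appT.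
- exists (step1 f); first by rewrite !mem_cat; apply/or4P/Or42/map_f; case: (f).
  apply/sat_Ex; exists j; split; first exact/sat_ltF.
  by apply/sat_entry; rewrite eval_appT.
- exists (step2 f); first by rewrite !mem_cat; apply/or4P/Or43/map_f; case: (f).
  apply/sat_Ex; exists j; apply/sat_Ex; exists k.
  split; first by split; apply/sat_ltF.
  by apply/sat_entry; rewrite eval_appT.
- exists (step3 f); first by rewrite !mem_cat; apply/or4P/Or44/map_f; case: (f).
  apply/sat_Ex; exists j; apply/sat_Ex; exists k; apply/sat_Ex; exists l.
  split; first by split; apply/sat_ltF.
  by split; [apply/sat_ltF|apply/sat_entry; rewrite eval_appT].
Qed.

Lemma appv0 f : appv (index0 f) [::] = codeT (App0 f).
Proof. by case: f. Qed.
Lemma appv1 f a : appv (index1 f) [:: codeT a] = codeT (App1 f a).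
Proof. by rewrite /appv /= codeTK /= index1K. Qed.
Lemma appv2 f a b :
  appv (index2 f) [:: codeT a; codeT b] = codeT (App2 f a b).
Proof. by rewrite /appv /= !codeTK /= index2K. Qed.
Lemma appv3 f a b c :
  appv (index3 f) [:: codeT a; codeT b; codeT c] = codeT (App3 f a b c).
Proof. by case: f; rewrite /appv /= !codeTK. Qed.

Lemma tclosed2 f a b : tclosed (App2 f a b) = tclosed a && tclosed b.
Proof. by rewrite /tclosed /= /nilp size_cat addn_eq0. Qed.

Lemma tclosed3 f a b c :
  tclosed (App3 f a b c) = [&& tclosed a, tclosed b & tclosed c].
Proof. by rewrite /tclosed /= /nilp !size_cat !addn_eq0. Qed.

(** The first m + 1 entries form a complete construction of the term with code
    a m, so strong induction recovers that term together with its value. *)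
Lemma built_sound a c m : (forall i, i <= m -> built a c i) ->
  exists t, [/\ tclosed t, a m = codeT t & c m = value t].
Proof.
elim/ltn_ind: m => m IH bm.
have {}IH j : j < m -> exists t, [/\ tclosed t, a j = codeT t & c j = value t].
  by move=> jm; apply: IH => // i ij; apply/bm/(leq_trans ij)/ltnW.
case: (bm m (leqnn m)) => [f -> ->|f j /IH[t [tc -> ->]] -> ->|
  f j k /IH[t [tc -> ->]] /IH[u [uc -> ->]] -> ->|
  f j k l /IH[t [tc -> ->]] /IH[u [uc -> ->]] /IH[w [wc -> ->]] -> ->].
- by exists (App0 f); rewrite appv0.
- by exists (App1 f t); rewrite appv1.
- by exists (App2 f t u); rewrite appv2 tclosed2 tc uc.
- by exists (App3 f t u w); rewrite appv3 tclosed3 tc uc wc.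
Qed.

Definition built_seq (l : seq term) : Prop := forall i, i < size l ->
  built (nth 0 (map codeT l)) (nth 0 (map value l)) i.

Lemma built_ext a a' c c' i : (forall j, j <= i -> a j = a' j) ->
  (forall j, j <= i -> c j = c' j) -> built a c i -> built a' c' i.
Proof.
move=> ea ec.
have la j : j < i -> a j = a' j by move=> /ltnW; apply: ea.
have lc j : j < i -> c j = c' j by move=> /ltnW; apply: ec.
case=> [f|f j ji|f j k ji ki|f j k l ji ki li].
- by rewrite ea // ec //; apply: built0.
- by rewrite ea // ec // !la // !lc //; apply: built1.
- by rewrite ea // ec // !la // !lc //; apply: built2.
- by rewrite ea // ec // !la // !lc //; apply: built3.
Qed.

Lemma built_rcons l t : built_seq l ->
  built (nth 0 (map codeT (rcons l t))) (nth 0 (map value (rcons l t)))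
    (size l) ->
  built_seq (rcons l t).
Proof.
move=> bl bt i; rewrite size_rcons ltnS leq_eqVlt => /orP[/eqP->//|il].
by apply: built_ext (bl i il) => j ji; rewrite map_rcons nth_rcons size_map
  (leq_ltn_trans ji il).
Qed.

Lemma nth_map_index T (g : term -> T) x0 l t u :
  u \in l -> nth x0 (map g (rcons l t)) (index u l) = g u.
Proof.
move=> ul; rewrite map_rcons nth_rcons size_map index_mem ul.
by rewrite (nth_map u) ?index_mem // nth_index.
Qed.

Lemma nth_map_last T (g : term -> T) x0 l t :
  nth x0 (map g (rcons l t)) (size l) = g t.
Proof. by rewrite map_rcons nth_rcons size_map ltnn eqxx. Qed.

(** Extending an arbitrary list, instead of building one for t alone, lets the
    constructions of several arguments be chained without merging lists. *)
Lemma built_extend t : tclosed t -> forall l, built_seq l ->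
  exists l', [/\ built_seq l', {subset l <= l'} & t \in l'].
Proof.
have last l u : built_seq (rcons l u) ->
    exists l', [/\ built_seq l', {subset l <= l'} & u \in l'].
  move=> b; exists (rcons l u); split=> // [w wl|].
    by rewrite mem_rcons inE wl orbT.
  by rewrite mem_rcons mem_head.
elim: t => [n|f|f a IHa|f a IHa b IHb|f a IHa b IHb c IHc] //.
- move=> _ l bl; apply/last/built_rcons => //; apply: (@built0 _ _ _ f).
    by rewrite nth_map_last appv0.
  by rewrite nth_map_last.
- move=> /IHa ha l /ha[la [bl sl al]].
  have [|l' [bl' sl' tl']] := last la (App1 f a).
    apply: built_rcons => //; apply: (@built1 _ _ _ f (index a la)).
    + by rewrite index_mem.
    + by rewrite nth_map_last nth_map_index // appv1.
    + by rewrite nth_map_last nth_map_index.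
  by exists l'; split=> // w /sl/sl'.
- rewrite tclosed2 => /andP[/IHa ha /IHb hb] l /ha[la [/hb[lb [bl sb bb]] sa aa]].
  have ab := sb _ aa.
  have [|l' [bl' sl' tl']] := last lb (App2 f a b).
    apply: built_rcons => //.
    apply: (@built2 _ _ _ f (index a lb) (index b lb)); rewrite ?index_mem //.
    + by rewrite nth_map_last !nth_map_index // appv2.
    + by rewrite nth_map_last !nth_map_index.
  by exists l'; split=> // w /sa/sb/sl'.
- rewrite tclosed3 => /and3P[/IHa ha /IHb hb /IHc hc] l.
  move=> /ha[la [/hb[lb [/hc[lc [bl sc cc]] sb bb]] sa aa]].
  have bc := sc _ bb; have ac := sc _ (sb _ aa).
  have [|l' [bl' sl' tl']] := last lc (App3 f a b c).
    apply: built_rcons => //.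
    apply: (@built3 _ _ _ f (index a lc) (index b lc) (index c lc));
      rewrite ?index_mem //.
    + by rewrite nth_map_last !nth_map_index // appv3.
    + by rewrite nth_map_last !nth_map_index.
  by exists l'; split=> // w /sa/sb/sc/sl'.
Qed.

(** The bound on the variables of s and u keeps them apart from the variables
    10 to 17 that are bound in [valF]. *)
Lemma sat_valF S rho s u : all (gtn 10) (tvars s) -> all (gtn 10) (tvars u) ->
  sat S rho (valF s u) <->
  exists t, [/\ tclosed t, eval rho s = codeT t & eval rho u = value t].
Proof.
move=> s10 u10.
have ev r : all (gtn 10) (tvars r) -> forall k l m,
    eval (update (update (update rho 10 k) 11 l) 12 m) r = eval rho r.
  move=> /allP rP k l m; apply: eval_ext => w /rP /= w10.
  by rewrite !updateE !ltn_eqF // (leq_trans w10).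
split=> [/sat_Ex[k /sat_Ex[l /sat_Ex[m /sat_And[/sat_entry E /sat_AllImp b]]]]
  |[t [tc st ut]]].
  move: E; rewrite (ev s) // (ev u) // => -[/= <- <-].
  apply: (built_sound (m := m)) => i im.
  have /sat_step : sat S (update (update (update (update rho 10 k) 11 l) 12 m)
                                 13 i) step.
    by apply: b; apply/sat_ltF.
  by rewrite /=.
have [|l [bl _ tl]] := built_extend tc (l := [::]); first by [].
apply/sat_Ex; exists (codeS (map codeT l)).
apply/sat_Ex; exists (codeS (map value l)).
apply/sat_Ex; exists (index t l); apply/sat_And; split.
  apply/sat_entry; rewrite (ev s) // (ev u) // st ut /= !codeSK.
  by split; rewrite (nth_map t) ?index_mem ?nth_index.
apply/sat_AllImp => i /sat_ltF il; apply/sat_step; rewrite /= !codeSK.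
apply: bl; have {}il : i < (index t l).+1 by apply: il.
by apply: leq_trans il _; rewrite index_mem.
Qed.

Lemma sat_sameval S rho s t u w :
  all (gtn 9) (tvars u) -> all (gtn 9) (tvars w) ->
  tclosed s -> tclosed t -> eval rho u = codeT s -> eval rho w = codeT t ->
  sat S rho (sameval u w) <-> value s = value t.
Proof.
move=> u9 w9 sc tc us wt.
have W r : all (gtn 9) (tvars r) -> all (gtn 10) (tvars r).
  by apply: sub_all => x /= /ltnW.
have ev r : all (gtn 9) (tvars r) -> forall n,
    eval (update rho 9 n) r = eval rho r.
  by move=> /allP rP n; apply: eval_update; apply/negP => /rP.
split=> [/sat_Ex[n /sat_And[/sat_valF hu /sat_valF hw]]|st].
  have [|//|s' [_]] := hu; [exact: W|rewrite ev // us => /codeT_inj<- /= <-].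
  have [|//|t' [_]] := hw; [exact: W|rewrite ev // wt => /codeT_inj<- /= <-].
  by [].
apply/sat_Ex; exists (value s); apply/sat_And.
split; apply/sat_valF => //; [exact: W| |exact: W|].
  by exists s; split=> //; rewrite ev.
by exists t; split=> //; rewrite ev.
Qed.

Lemma sat_AtVal S rho t y z A : y < 10 -> z < 10 -> y != z -> tclosed t ->
  rho z = codeT t ->
  sat S (update rho y (value t)) A -> sat S rho (AtVal (Var z) y A).
Proof.
move=> y10 z10 yz tc zt h; apply/sat_AllImp => n /sat_valF.
rewrite /= y10 z10 => -[] // t' [_].
by rewrite !updateE eqxx eq_sym (negPf yz) zt => /codeT_inj <- ->.
Qed.

(** * Strong Kleene satisfaction *)

Lemma negC_code A : sentence A -> negC (code A) = code (Neg A).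
Proof. by move=> Ac; rewrite /negC codeFK Ac. Qed.

Lemma negC_nonSent n : ~ Sent n -> negC n = code (Eq (App0 Zero) (App0 Zero)).
Proof.
rewrite /negC; case E: (decF n) => [A|] //.
by case: ifP => // Ac []; exists A; rewrite -?(decFP E).
Qed.

Lemma fixed_code X A : X = K X -> sentence A -> X (code A) <-> Kclause X A.
Proof.
move=> hfix Ac; rewrite {1}hfix; split=> [[B [_ /code_inj-> //]]|hA].
by exists A.
Qed.

(** Numbers that are not sentences are negated to 0 = 0, which is in every
    fixed point. *)
Lemma fixed_negC X n : X = K X -> ~ Sent n -> X (negC n).
Proof. by move=> hfix /negC_nonSent->; apply/fixed_code. Qed.

(** [ksat X true] and [ksat X false] are Strong Kleene truth and falsity when
    the truth predicate has extension X and anti-extension {n | negC n in X}.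
    That anti-extension contains every number that is not a sentence if X is a
    fixed point, so the clause of K for such numbers needs no disjunct here. *)
Fixpoint ksat (X : set nat) (b : bool) (rho : nat -> nat) A : Prop :=
  match A with
  | Eq s t => if b then eval rho s = eval rho t else eval rho s <> eval rho t
  | Tr t => if b then X (eval rho t) else X (negC (eval rho t))
  | Neg B => ksat X (~~ b) rho B
  | And B C => if b then ksat X b rho B /\ ksat X b rho C
               else ksat X b rho B \/ ksat X b rho C
  | All v B => if b then forall n, ksat X b (update rho v n) B
               else exists n, ksat X b (update rho v n) B
  end.

Definition signed (b : bool) A := if b then A else Neg A.

Lemma ksat_subst X b rho v u A : tclosed u ->
  ksat X b rho (subst v u A) <-> ksat X b (update rho v (value u)) A.
Proof.
move=> uc; elim: A b rho => [s t|t|B IH|B IHB C IHC|w B IH] b rho /=.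
- by rewrite !eval_tsubst (eval_closed _ uc).
- by rewrite eval_tsubst (eval_closed _ uc).
- exact: IH.
- by have := (IHB b rho, IHC b rho); case: b; tauto.
- case: eqP => [->|/eqP wv] /=.
    case: b; first by split=> h n; move: (h n); rewrite update_same.
    by split=> -[n h]; exists n; move: h; rewrite update_same.
  have swap n : ksat X b (update rho w n) (subst v u B) <->
      ksat X b (update (update rho v (value u)) w n) B.
    by rewrite update_swap //; apply: IH.
  case: b swap => swap; first by split=> h n; apply/swap/h.
  by split=> -[n h]; exists n; apply/swap.
Qed.

Fixpoint fsize A : nat :=
  match A with
  | Eq _ _ | Tr _ => 1
  | Neg B | All _ B => (fsize B).+1
  | And B C => (fsize B + fsize C).+1
  end.

Lemma fsize_subst v u A : fsize (subst v u A) = fsize A.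
Proof.
by elim: A => //= [B ->|B -> C ->|w B IH] //; case: eqP => //= _; rewrite IH.
Qed.

(** The clauses of K and of [ksat] match, since in N the closed instances of a
    formula cover all its values.  The induction is on the size because the
    quantifier clause of K passes to instances, not to subformulas. *)
Lemma ksatP X b rho A : X = K X -> sentence A ->
  X (code (signed b A)) <-> ksat X b rho A.
Proof.
move=> hfix; have [n] := ubnP (fsize A); elim: n A b rho => // n IH A b rho lt Ac.
have sc : sentence (signed b A) by case: b.
apply: (iff_trans (fixed_code hfix sc)).
case: A lt Ac {sc} => [s t|t|B|B C|v B] /= lt Ac.
- have /andP[sc tc] : tclosed s && tclosed t.
    by rewrite /tclosed /nilp -addn_eq0 -size_cat; exact: Ac.
  by rewrite !eval_closed //; case: b.
- rewrite eval_closed //; case: b => //=.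
  by split=> [[//|]|]; [apply: fixed_negC|left].
- case: b => /=; last exact: (IH B true).
  apply: iff_trans (IH B false rho lt Ac) => /=.
  by apply: iff_sym; apply: (iff_trans _ (fixed_code hfix Ac)).
- move: Ac; rewrite sentence_And => /andP[Bc Cc].
  have ltB : fsize B < n by apply: leq_ltn_trans (leq_addr _ _) lt.
  have ltC : fsize C < n by apply: leq_ltn_trans (leq_addl _ _) lt.
  by have := (IH B b rho ltB Bc, IH C b rho ltC Cc); case: b; rewrite /=; tauto.
- have inst t : tclosed t -> X (code (signed b (subst v t B))) <->
      ksat X b (update rho v (value t)) B.
    move=> tc; apply: iff_trans (ksat_subst _ _ _ _ _ tc).
    by apply: IH; rewrite ?fsize_subst // sentence_subst // -sentence_All.
  case: b inst => /= inst; split.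
  + move=> h m; rewrite -(value_numeral m).
    exact/(inst _ (tclosed_numeral m))/h/tclosed_numeral.
  + by move=> h t tc; apply/(inst t tc).
  + by move=> [t tc h]; exists (value t); apply/(inst t tc).
  + move=> [m h]; exists (numeral m); first exact: tclosed_numeral.
    by apply/(inst _ (tclosed_numeral m)); rewrite value_numeral.
Qed.

(** * Determinateness and truth over a consistent fixed point *)

Definition consistent_fixed_point (X : set nat) : Prop :=
  [/\ X `<=` Sent, X = K X & consistent X].

Definition determinate (X : set nat) n := X n \/ X (negC n).

Lemma consistent_negC X n : consistent_fixed_point X -> X n -> ~ X (negC n).
Proof.
move=> [hSent hfix hcons] Xn; have [A Ac nA] := hSent _ Xn; subst n.
rewrite negC_code // => XnA; apply: hcons; exists A => //.
by apply/fixed_code => //; rewrite sentence_And Ac.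
Qed.

(** The only clause that can fail classically is that of neg T(t), where the
    anti-extension must be disjoint from X. *)
Lemma ksat_sound X b rho A : consistent_fixed_point X ->
  ksat X b rho A -> sat X rho (signed b A).
Proof.
move=> hX; elim: A b rho => [s t|t|B IH|B IHB C IHC|v B IH] [] rho //=.
- by move=> XnA XA; apply: consistent_negC hX XA XnA.
- exact: (IH false).
- by move=> /(IH true) hB; apply.
- by move=> [/(IHB true) hB /(IHC true) hC].
- by move=> [/(IHB false) hB|/(IHC false) hC] [].
- by move=> h n; apply/(IH true)/h.
- by move=> [n /(IH false) h] /(_ n).
Qed.

Lemma truths_code X rho A : sentence A ->
  truths X (code A) <-> sat X rho A.
Proof.
move=> Ac; split=> [[B [_ /code_inj-> //]]|hA].
by exists A; split=> // rho'; apply/(sat_sentence _ rho).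
Qed.

Lemma truths_subst X rho v A t : fml1 v A -> tclosed t ->
  truths X (code (subst v t A)) <-> sat X (update rho v (value t)) A.
Proof.
move=> vA tc; have Ac : sentence (subst v t A) by rewrite sentence_subst.
apply: iff_trans (truths_code X rho Ac) _.
apply: iff_trans (sat_subst _ _ _ (closed_subset v tc)) _.
by rewrite eval_closed.
Qed.

Lemma determinate_code X rho A : X = K X -> sentence A ->
  determinate X (code A) <-> ksat X true rho A \/ ksat X false rho A.
Proof.
move=> hfix Ac; rewrite /determinate negC_code //.
have := (ksatP true rho hfix Ac, ksatP false rho hfix Ac).
by rewrite /=; tauto.
Qed.

(** If n is true in (N, X) but its negation lies in X, then soundness makes the
    negation true as well; so a determinate truth lies in X. *)
Lemma determinate_truths X n : consistent_fixed_point X ->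
  determinate X n -> truths X n <-> X n.
Proof.
move=> hX; have [hSent hfix _] := hX; move=> D.
have rho : nat -> nat by [].
split=> [[A [Ac nA hA]]|Xn].
  case: D => //; rewrite nA negC_code // => /(ksatP false rho hfix Ac).
  by move=> /(ksat_sound hX)[]; apply: hA.
have [A Ac nA] := hSent _ Xn; move: Xn; rewrite nA.
by move=> /(ksatP true rho hfix Ac)/(ksat_sound hX)/(truths_code X rho Ac).
Qed.

Lemma sat_Det_fixed X rho u : X = K X ->
  sat X rho (Det u) <-> determinate X (eval rho u).
Proof.
move=> hfix; apply: (iff_trans (sat_Or _ _ _ _)); rewrite /= !codeTK.
have c1 : sentence (Tr (numeral (eval rho u))) by exact: tclosed_numeral.
have c2 : sentence (Fa (numeral (eval rho u))) by exact: tclosed_numeral.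
have := (ksatP true rho hfix c1, ksatP true rho hfix c2).
by rewrite /= !eval_numeral /determinate; tauto.
Qed.

Lemma sat_Det_truths X rho u :
  sat (truths X) rho (Det u) <-> determinate X (eval rho u).
Proof.
apply: (iff_trans (sat_Or _ _ _ _)); rewrite /= !codeTK.
have c1 : sentence (Tr (numeral (eval rho u))) by exact: tclosed_numeral.
have c2 : sentence (Fa (numeral (eval rho u))) by exact: tclosed_numeral.
have := (truths_code X rho c1, truths_code X rho c2).
by rewrite /= !eval_numeral /determinate; tauto.
Qed.

(** The order of the rules matters: D(u) is itself a disjunction and has to be
    recognized before the rule for disjunctions applies. *)
Lemma satE :
  (forall S rho A B,
     sat S rho (Iff A B) = (sat S rho A <-> sat S rho B)) *
  (forall X rho u,
     sat (truths X) rho (Det u) = determinate X (eval rho u)) *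
  (forall S rho A B, sat S rho (Or A B) = (sat S rho A \/ sat S rho B)) *
  (forall S rho A B, sat S rho (And A B) = (sat S rho A /\ sat S rho B)) *
  (forall S rho t, sat S rho (Tr t) = S (eval rho t)).
Proof.
split; [split; [split; [split|]|]|] => //.
- by move=> *; apply/propext/sat_Iff.
- by move=> *; apply/propext/sat_Det_truths.
- by move=> *; apply/propext/sat_Or.
Qed.

Lemma fn3_SubC f v A t :
  fn3 f (code A) (codeT (Var v)) (codeT t) = code (subst v t A).
Proof. by rewrite /fn3 codeFK !codeTK. Qed.

(** * The axioms for T and D *)

Lemma holds_T1 X : holds (truths X) T1.
Proof.
move=> rho; apply/sat_AllClT => s sc; apply/sat_AllClT => t tc; apply/sat_Iff.
apply: (iff_trans _ (iff_sym (@sat_sameval _ _ s t _ _ _ _ _ _ _ _))) => //.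
rewrite /= !updateE /= !codeTK.
have stc : sentence (Eq s t).
  by rewrite /sentence /= /nilp size_cat addn_eq0; apply/andP.
by apply: iff_trans (truths_code X rho stc) _; rewrite /= !eval_closed.
Qed.

Lemma sentence_Det t : tclosed t -> sentence (Det t).
Proof. by move=> /nilP t0; rewrite /sentence /= t0. Qed.

Lemma holds_T2plus X : consistent_fixed_point X -> holds (truths X) T2plus.
Proof.
move=> [_ hfix _] rho; apply/sat_AllClT => t tc; apply: (sat_AtVal (t := t)) => //.
rewrite !satE /= !updateE /= codeTK.
apply: iff_sym; apply: iff_trans (truths_code X rho (sentence_Det tc)) _.
by apply: iff_trans (sat_Det_fixed _ _ hfix) _; rewrite eval_closed.
Qed.

Lemma holds_T3 X : consistent_fixed_point X -> holds (truths X) T3.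
Proof.
move=> hX rho; apply/sat_AllClT => t tc; apply: (sat_AtVal (t := t)) => //.
apply/sat_Imp; rewrite !satE /= !updateE /= codeTK => D.
apply: iff_trans (iff_sym (determinate_truths hX D)).
by apply: iff_trans (truths_code X rho _) _ => //=; rewrite eval_closed.
Qed.

Lemma holds_T4 X : holds (truths X) T4.
Proof.
move=> rho; apply/sat_AllSent => A Ac; apply/sat_Iff.
rewrite /= !updateE /= negC_code //.
by have := (truths_code X rho Ac, truths_code X (A := Neg A) rho Ac); rewrite /=; tauto.
Qed.

Lemma holds_T5 X : holds (truths X) T5.
Proof.
move=> rho; apply/sat_AllSent => A Ac; apply/sat_AllSent => B Bc.
rewrite !satE /= !updateE /= !codeFK.
have ABc : sentence (And A B) by rewrite sentence_And Ac.
have := (truths_code X rho Ac, truths_code X rho Bc, truths_code X rho ABc).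
by rewrite /=; tauto.
Qed.

Lemma holds_T6 X : holds (truths X) T6.
Proof.
move=> rho; apply/sat_AllFml1 => // v A vA; apply/sat_Iff.
apply: (iff_trans _ (iff_sym (sat_AllClT _ _ _ _))).
rewrite satE /= !updateE /= codeTK codeFK.
have Ac : sentence (All v A) by rewrite sentence_All.
apply: iff_trans (truths_code X rho Ac) _ => /=.
split=> [h t tc|h n].
  by rewrite /= !updateE /= fn3_SubC; apply/(truths_subst X rho vA tc)/h.
have := h _ (tclosed_numeral n); rewrite /= !updateE /= fn3_SubC.
by move=> /(truths_subst X rho vA (tclosed_numeral n)); rewrite value_numeral.
Qed.

Lemma holds_D1 X : consistent_fixed_point X -> holds (truths X) D1.
Proof.
move=> [_ hfix _] rho; apply/sat_AllClT => s sc; apply/sat_AllClT => t tc.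
rewrite satE /= !updateE /= !codeTK.
have stc : sentence (Eq s t).
  by rewrite /sentence /= /nilp size_cat addn_eq0; apply/andP.
by apply/(determinate_code rho hfix stc) => /=; apply: EM.
Qed.

Lemma holds_D2 X : consistent_fixed_point X -> holds (truths X) D2.
Proof.
move=> [_ hfix _] rho; apply/sat_AllClT => t tc; apply: (sat_AtVal (t := t)) => //.
rewrite !satE /= !updateE /= codeTK.
apply: (iff_trans (@determinate_code _ rho (Tr t) hfix tc)) => /=.
by rewrite eval_closed.
Qed.

Lemma holds_D3 X : consistent_fixed_point X -> holds (truths X) D3.
Proof.
move=> [_ hfix _] rho; apply/sat_AllClT => t tc; apply: (sat_AtVal (t := t)) => //.
rewrite !satE /= !updateE /= codeTK.
apply: (iff_trans (determinate_code rho hfix (sentence_Det tc))) => /=.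
rewrite !eval_closed // !codeTK; set n := value t.
have c1 : sentence (Tr (numeral n)) by exact: tclosed_numeral.
have c2 : sentence (Fa (numeral n)) by exact: tclosed_numeral.
(* D(t) is Kleene-true iff n is determinate; its Kleene falsity entails that of
   T(num n), that is, negC n in X, hence again that n is determinate. *)
rewrite !negC_code //.
have := (ksatP true rho hfix c1, ksatP true rho hfix c2, ksatP false rho hfix c1).
by rewrite /= !eval_numeral /determinate; tauto.
Qed.

Lemma holds_D4 X : consistent_fixed_point X -> holds (truths X) D4.
Proof.
move=> [_ hfix _] rho; apply/sat_AllSent => A Ac.
rewrite !satE /= !updateE /= negC_code //.
have := (determinate_code rho hfix Ac,
         @determinate_code _ rho (Neg A) hfix Ac).
by rewrite /=; tauto.
Qed.

(** A Kleene-true sentence is true, so its negation cannot be: determinateness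
    together with classical falsity leaves only Kleene falsity. *)
Lemma determinate_false X rho A : consistent_fixed_point X -> sentence A ->
  determinate X (code A) /\ truths X (negC (code A)) <-> ksat X false rho A.
Proof.
move=> hX Ac; have [_ hfix _] := hX; rewrite negC_code //.
have hD := determinate_code rho hfix Ac.
have hT := truths_code X (A := Neg A) rho Ac.
split=> [[/hD[/(ksat_sound hX) /= hA|//] /hT]|h]; first by [].
by split; [apply/hD; right|apply/hT/(ksat_sound hX h)].
Qed.

Lemma holds_D5 X : consistent_fixed_point X -> holds (truths X) D5.
Proof.
move=> hX; have [_ hfix _] := hX.
move=> rho; apply/sat_AllSent => A Ac; apply/sat_AllSent => B Bc.
rewrite !satE.
rewrite /= !updateE /= !codeFK.
have ABc : sentence (And A B) by rewrite sentence_And Ac.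
have := (determinate_false rho hX Ac, determinate_false rho hX Bc).
have := (determinate_code rho hfix ABc, determinate_code rho hfix Ac, determinate_code rho hfix Bc).
by rewrite /=; tauto.
Qed.

Lemma determinate_subst X rho v A t : X = K X -> fml1 v A -> tclosed t ->
  determinate X (code (subst v t A)) <->
  ksat X true (update rho v (value t)) A \/
  ksat X false (update rho v (value t)) A.
Proof.
move=> hfix vA tc; have Ac : sentence (subst v t A) by rewrite sentence_subst.
have := (ksat_subst X true rho v A tc, ksat_subst X false rho v A tc).
by have := determinate_code rho hfix Ac; tauto.
Qed.

Lemma holds_D6 X : consistent_fixed_point X -> holds (truths X) D6.
Proof.
move=> hX; have [_ hfix _] := hX.
move=> rho; apply/sat_AllFml1 => // v A vA; apply/sat_Iff.
set rho' := update _ 0 _.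
have Ac : sentence (All v A) by rewrite sentence_All.
have At t : tclosed t -> sentence (subst v t A) by move=> ?; rewrite sentence_subst.
pose k b n := ksat X b (update rho v n) A.
have D t : tclosed t -> determinate X (code (subst v t A)) <->
    k true (value t) \/ k false (value t).
  exact: determinate_subst.
apply: (iff_trans (B := (forall n, k true n) \/ exists n, k false n)).
  rewrite satE /rho' /= !updateE /= codeTK codeFK.
  exact: (determinate_code rho hfix Ac).
apply: iff_sym; apply: iff_trans (sat_Or _ _ _ _) _.
have allD : sat (truths X) rho'
      (AllClT 3 (Det (App3 SubC (Var 0) (Var 4) (Var 3)))) <-> forall n, k true n \/ k false n.
  apply: iff_trans (sat_AllClT _ _ _ _) _; split=> h => [n|t tc].
    have := h _ (tclosed_numeral n); rewrite satE /rho' /= !updateE /= fn3_SubC.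
    by move=> /(D _ (tclosed_numeral n)); rewrite value_numeral.
  by rewrite satE /rho' /= !updateE /= fn3_SubC; apply/(D t tc).
have exF : sat (truths X) rho' (ExClT 3 (And
      (Det (App3 SubC (Var 0) (Var 4) (Var 3)))
      (Tr (App1 NegC (App3 SubC (Var 0) (Var 4) (Var 3))))))
    <-> exists n, k false n.
  have F t : tclosed t -> determinate X (code (subst v t A)) /\
      truths X (negC (code (subst v t A))) <-> k false (value t).
    move=> tc; apply: iff_trans (determinate_false rho hX (At t tc)) _.
    exact: ksat_subst.
  apply: iff_trans (sat_ExClT _ _ _ _) _; split=> [[t tc]|[n kn]].
    rewrite !satE /rho' /= !updateE /= fn3_SubC => /(F t tc) kt.
    by exists (value t).
  exists (numeral n); first exact: tclosed_numeral.
  rewrite !satE /rho' /= !updateE /= fn3_SubC.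
  by apply/(F _ (tclosed_numeral n)); rewrite value_numeral.
split=> [[/allD h|/exF h]|[h|h]].
(* with values everywhere and no falsity, every instance is Kleene-true *)
- have [|hF] := EM (exists n, k false n); first by right.
  by left=> n; have [//|kn] := h n; case: hF; exists n.
- by right.
- by left; apply/allD => n; left.
- by right; apply/exF.
Qed.

Lemma holds_R1 X : holds (truths X) R1.
Proof.
move=> rho; apply/sat_AllFml1 => // v A vA.
apply/sat_AllClT => s sc; apply/sat_AllClT => t tc; apply/sat_Imp.
move=> /sat_sameval st; have {}st : value s = value t by apply: st.
rewrite !satE /= !updateE /= !fn3_SubC.
have := (truths_subst X rho vA sc, truths_subst X rho vA tc).
by rewrite st; tauto.
Qed.

Lemma holds_R2 X : consistent_fixed_point X -> holds (truths X) R2.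
Proof.
move=> [_ hfix _] rho; apply/sat_AllFml1 => // v A vA.
apply/sat_AllClT => s sc; apply/sat_AllClT => t tc; apply/sat_Imp.
move=> /sat_sameval st; have {}st : value s = value t by apply: st.
rewrite !satE /= !updateE /= !fn3_SubC.
have := (determinate_subst rho hfix vA sc, determinate_subst rho hfix vA tc).
by rewrite st; tauto.
Qed.

(** * Peano arithmetic and the theorem *)

Lemma sat_arithmetical S S' rho A :
  arithmetical A -> sat S rho A <-> sat S' rho A.
Proof.
elim: A rho => [s t|t|B IH|B IHB C IHC|v B IH] rho //=.
- by move=> /(IH rho); tauto.
- by move=> /andP[/(IHB rho) + /(IHC rho)]; tauto.
- by move=> Ba; split=> h n; apply/(IH _ Ba)/h.
Qed.

Lemma holds_uclosure S A : holds S A -> holds S (uclosure A).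
Proof.
rewrite /uclosure => hA; elim: (undup _) => //= v s IH rho n; exact: IH.
Qed.

Lemma holds_induction S v A : holds S (induction v A).
Proof.
apply: holds_uclosure => rho; apply/sat_Imp => /sat_And[h0 /sat_AllImp hS].
apply/sat_All; elim=> [|n IH].
  by move/(sat_subst _ _ _ (u := App0 Zero)): h0; apply.
move/sat_subst: (hS n IH); rewrite /= updateE eqxx update_same; exact.
Qed.

Lemma holds_PA_T Syn S : syntax_axioms Syn -> models S (PA_T Syn).
Proof.
move=> hSyn A; case=> {A}.
- by move=> A /hSyn[_ Aa hA] rho; apply/(sat_arithmetical S set0 rho Aa)/hA.
- by move=> rho n.
- by move=> rho; apply/sat_All => m; apply/sat_AllImp => n /= -[].
- by move=> rho n; apply: addn0.
- by move=> rho n m; apply: addnS.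
- by move=> rho n; apply: muln0.
- by move=> rho n m; apply: etrans (mulnS _ _) (addnC _ _).
- exact: holds_induction.
Qed.

Theorem mainTheorem1 (Syn : set formula) (X : set nat)
  (hSyn : syntax_axioms Syn)
  (hSent : X `<=` Sent) (hfix : X = K X) (hcons : consistent X) :
  models (truths X) (CDplus_T Syn).
Proof.
have hX : consistent_fixed_point X by [].
move=> A; case=> {A}; first exact: holds_PA_T.
- exact: holds_T1.
- exact: holds_T2plus.
- exact: holds_T3.
- exact: holds_T4.
- exact: holds_T5.
- exact: holds_T6.
- exact: holds_D1.
- exact: holds_D2.
- exact: holds_D3.
- exact: holds_D4.
- exact: holds_D5.
- exact: holds_D6.
- exact: holds_R1.
- exact: holds_R2.
Qed.
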